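(* Let $A$ be a finite set with $|A|\ge2$ and let $n\ge2$. Any transformation $f$ of $A^n$ can be computed with $n-1$ memory cells and no more than $2n-1$ instructions: $\mathcal{L}(f|n-1)\le 2n-1$.
   Context: For $N\ge1$, a transformation of $A^N$ is a map $h=(h_1,\dots,h_N):A^N\to A^N$; its coordinate function $h_i:A^N\to A$ is trivial if $h_i(x)=x_i$ for all $x$. An instruction of $A^N$ is a transformation of $A^N$ with at most one nontrivial coordinate function. A program of length $L$ computing $h$ is a sequence of instructions $g^1,\dots,g^L$ of $A^N$ with $h=g^L\circ\cdots\circ g^1$. The procedural complexity $\mathcal{L}(h)$ is the shortest length of a program computing $h$; the identity has procedural complexity $0$. For a transformation $f$ of $A^n$, $D(f,m)$ is the set of transformations $h$ of $A^{n+m}$ such that $h_i(x_1,\dots,x_{n+m})=f_i(x_1,\dots,x_n)$ for all $1\le i\le n$ and all $(x_1,\dots,x_{n+m})\in A^{n+m}$. The shortest length of a program computing $f$ using $m$ memory cells is $\mathcal{L}(f|m):=\min_{h\in D(f,m)}\mathcal{L}(h)$. *)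

(* Defs.v *)
From mathcomp Require Import all_boot all_fingroup.

Set Implicit Arguments.
Unset Strict Implicit.
Unset Printing Implicit Defensive.

(* [(A ^ N)%type] is MathComp's notation for [{ffun 'I_N -> A}].  Finite      *)
(* functions make the transformations of A^N a finType with extensional       *)
(* equality.                                                                  *)
Definition transf (A : finType) (N : nat) : finType :=
  {ffun (A ^ N)%type -> (A ^ N)%type}.

Section ProceduralComplexity.

Variables (A : finType) (N : nat).

Implicit Types (h g : transf A N) (p : seq (transf A N)) (x y : (A ^ N)%type).

Definition trivial_coord h (i : 'I_N) : bool := [forall x, h x i == x i].

Definition is_instruction g : bool := #|[set i | ~~ trivial_coord g i]| <= 1.

(* The head of [p] is applied first: [run [:: g1; ...; gL]] is gL o ... o g1. *)
Definition run p x : (A ^ N)%type := foldl (fun y (g : transf A N) => g y) x p.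

Definition program_computes p h : bool :=
  all is_instruction p && [forall x, run p x == h x].

Definition computable_in h (L : nat) : bool :=
  [exists p : L.-tuple (transf A N), program_computes p h].

Definition transf_id : transf A N := [ffun x => x].

(* The lemmas below show that the instructions generate the full              *)
(* transformation monoid, so that the minimum defining the procedural         *)
(* complexity is always over a nonempty set.                                  *)

Let gen (u : (A ^ N)%type -> (A ^ N)%type) :=
  exists2 p, all is_instruction p & run p =1 u.

Let gen_eq u v : gen u -> u =1 v -> gen v.
Proof. by move=> [p p_i pE] uv; exists p => // x; rewrite pE uv. Qed.

Let gen_comp u v : gen u -> gen v -> gen (v \o u).
Proof.
move=> [p p_i pE] [q q_i qE]; exists (p ++ q); first by rewrite all_cat p_i.
by move=> x; rewrite /run foldl_cat -/(run p x) pE -/(run q _) qE.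
Qed.

Let gen_id : gen id.
Proof. by exists [::]. Qed.

Let gen_instr (i : 'I_N) h :
  (forall x j, j != i -> h x j = x j) -> gen h.
Proof.
move=> hi; exists [:: h] => //=; rewrite andbT /is_instruction.
rewrite -(cards1 i) subset_leq_card //; apply/subsetP => j; rewrite !inE.
by apply: contraR => /hi hj; apply/forallP => x; rewrite hj.
Qed.

Let adj i x y := forall j, j != i -> x j = y j.

Let gen_tperm_adj i x y : adj i x y -> gen (tperm x y).
Proof.
move=> xy; pose h : transf A N := [ffun z => tperm x y z].
apply: (@gen_eq h); last by move=> z; rewrite ffunE.
apply: (@gen_instr i) => z j /xy xyj; rewrite ffunE.
by case: tpermP => [->|->|].
Qed.

Let merge x y z := if z == x then y else z.

Let gen_merge_adj i x y : adj i x y -> gen (merge x y).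
Proof.
move=> xy; pose h : transf A N := [ffun z => merge x y z].
apply: (@gen_eq h); last by move=> z; rewrite ffunE.
apply: (@gen_instr i) => z j /xy xyj; rewrite ffunE /merge.
by case: eqP => [->|].
Qed.

Let step i y x : (A ^ N)%type := [ffun j => if j == i then y j else x j].

Let step_adj i y x : adj i x (step i y x).
Proof. by move=> j /negPf ji; rewrite ffunE ji. Qed.

Let gen_tperm x y : gen (tperm x y).
Proof.
have [k] := ubnP #|[set i | x i != y i]|; elim: k x => // k IHk x le_k.
have [-> | neq_xy] := eqVneq x y.
  by apply: gen_eq gen_id _ => z; rewrite tperm1 perm1.
have [i xi] : exists i, x i != y i.
  apply/existsP; apply: contraR neq_xy => /existsPn xy.
  by apply/eqP/ffunP => i; apply/eqP; rewrite -[_ == _]negbK xy.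
pose z := step i y x.
have gxz : gen (tperm x z) by apply: (@gen_tperm_adj i); apply: step_adj.
have [<- // | neq_zy] := eqVneq z y.
have gzy : gen (tperm z y).
  apply: IHk; rewrite ltnS in le_k; apply: leq_trans le_k.
  apply: proper_card; apply/properP; split.
    by apply/subsetP => j; rewrite !inE ffunE; case: ifP => //; rewrite eqxx.
  by exists i; rewrite !inE // ffunE !eqxx.
apply: gen_eq (gen_comp (gen_comp gxz gzy) gxz) _ => w /=.
have -> : tperm x y = (tperm z y ^ tperm x z)%g.
  by rewrite tpermJ tpermR tpermD // eq_sym.
by rewrite conjgE tpermV !permM.
Qed.

Let gen_perm (s : {perm (A ^ N)%type}) : gen s.
Proof.
have [ts -> _] := prod_tpermP s.
elim: ts => [|t ts IHts]; first by apply: gen_eq gen_id _ => x; rewrite big_nil perm1.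
apply: gen_eq (gen_comp (gen_tperm t.1 t.2) IHts) _ => x /=.
by rewrite big_cons permM.
Qed.

Let gen_merge x y : gen (merge x y).
Proof.
have [-> | neq_xy] := eqVneq x y.
  by apply: gen_eq gen_id _ => z; rewrite /merge; case: eqP.
have [i xi] : exists i, x i != y i.
  apply/existsP; apply: contraR neq_xy => /existsPn xy.
  by apply/eqP/ffunP => i; apply/eqP; rewrite -[_ == _]negbK xy.
pose z := step i y x.
have neq_xz : x != z by apply: contraNneq xi => ->; rewrite ffunE eqxx.
have gxz : gen (merge x z) by apply: (@gen_merge_adj i); apply: step_adj.
apply: gen_eq (gen_comp (gen_comp (gen_tperm z y) gxz) (gen_tperm z y)) _ => w /=.
have tx : tperm z y x = x by rewrite tpermD // eq_sym.
rewrite /merge -{1}tx (inj_eq perm_inj).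
by case: eqP => _; rewrite ?tpermL // tpermK.
Qed.

Let gen_all h : gen h.
Proof.
have [k] := ubnP (#|{: (A ^ N)%type}| - #|codom h|); elim: k h => // k IHk h le_k.
have [/injectiveP h_inj | /injectivePn [a [b neq_ab eq_hab]]] := boolP (injectiveb h).
  by apply: gen_eq (gen_perm (perm h_inj)) _ => x; rewrite permE.
have lt_im : #|codom h| < #|{: (A ^ N)%type}|.
  rewrite ltn_neqAle max_card andbT; apply/negP => /eqP/esym eq_im.
  have /image_injP hI : #|image h predT| == #|{: (A ^ N)%type}| by rewrite -eq_im.
  by move: neq_ab; rewrite (hI _ _ _ _ eq_hab) ?eqxx.
have [c c_im] : exists c, c \notin codom h.
  apply/existsP; apply: contraLR lt_im => /existsPn all_im.
  rewrite -leqNgt; apply: subset_leq_card; apply/subsetP => c _.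
  by have := all_im c; rewrite negbK.
pose h' : transf A N := [ffun x => if x == a then c else h x].
have gh' : gen h'.
  apply: IHk; rewrite ltnS in le_k; apply: leq_trans le_k.
  apply: ltn_sub2l => //; apply: proper_card; apply/properP; split.
    apply/subsetP => _ /codomP [x ->].
    have [-> | neq_xa] := eqVneq x a.
      by apply/codomP; exists b; rewrite ffunE eq_sym (negPf neq_ab).
    by apply/codomP; exists x; rewrite ffunE (negPf neq_xa).
  by exists c => //; apply/codomP; exists a; rewrite ffunE eqxx.
apply: gen_eq (gen_comp gh' (gen_merge c (h a))) _ => x /=.
rewrite /merge ffunE; have [-> | _] := eqVneq x a; first by rewrite eqxx.
by case: eqP => // hx; case/negP: c_im; rewrite -hx codom_f.
Qed.

Lemma ex_computable_in h : exists L, computable_in h L.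
Proof.
have [p p_i pE] := gen_all h; exists (size p); apply/existsP; exists (in_tuple p).
by rewrite /program_computes p_i; apply/forallP => x; rewrite pE.
Qed.

Definition procedural_complexity h : nat := ex_minn (ex_computable_in h).

End ProceduralComplexity.

Section Memory.

Variables (A : finType) (n : nat) (f : transf A n) (m : nat).

(* The first n cells of A^(n+m) are those indexed by [lshift m i], i : 'I_n;  *)
(* the other m are the memory cells.                                          *)
Definition first_cells (x : (A ^ (n + m))%type) : (A ^ n)%type :=
  [ffun i => x (lshift m i)].

Definition mem_extensions : {set transf A (n + m)} :=
  [set h : transf A (n + m) |
    [forall x, forall i : 'I_n, h x (lshift m i) == f (first_cells x) i]].

Lemma ex_mem_complexity :
  exists L, [exists h in mem_extensions, procedural_complexity h == L].
Proof.
pose h : transf A (n + m) := [ffun x : (A ^ (n + m))%type =>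
  [ffun k => if split k is inl i then f (first_cells x) i else x k]].
exists (procedural_complexity h); apply/existsP; exists h; rewrite eqxx andbT inE.
apply/forallP => x; apply/forallP => i; rewrite !ffunE.
by rewrite (unsplitK (inl i)).
Qed.

Definition procedural_complexity_mem : nat := ex_minn ex_mem_complexity.

End Memory.

(* Main.v *)
(* Store f_1(x), ..., f_{n-1}(x) in the n - 1 memory cells, then overwrite    *)
(* x_n by f_n(x), then copy the memory cells back to x_1, ..., x_{n-1}.       *)

Require Import Defs.
From mathcomp Require Import all_boot.

(** The order of the writes ensures that no instruction needs a value already lost. While the
    [n - 1] memory cells receive the first coordinates of [f], the input stays intact, so every
    coordinate of [f] can still be evaluated. The write to the last cell is the final one to read
    the input; the copies then read memory only. This takes (n - 1) + 1 + (n - 1) = 2n - 1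
    instructions. Both blocks of n - 1 writes are covered by [run_assign];
    [procedural_complexity_mem_le] turns the program into a bound. *)

Section Assignments.

Variables (A : finType) (N : nat).
Implicit Types (u : 'I_N -> (A ^ N)%type -> A) (k : 'I_N) (ks : seq 'I_N).

Definition assign u k : transf A N :=
  [ffun x : (A ^ N)%type => [ffun j => if j == k then u k x else x j]].

Lemma assign_instruction u k : is_instruction (assign u k).
Proof.
rewrite /is_instruction -(cards1 k) subset_leq_card //.
apply/subsetP => j; rewrite !inE; apply: contraR => /negPf jk.
by apply/forallP => x; rewrite !ffunE jk.
Qed.

(** Sequential writes agree with a simultaneous update when no written value depends on a written
    cell: each [u k] then sees the same data before and after the other writes. *)
Lemma run_assign u ks x j :
    uniq ks ->
    (forall k (y z : (A ^ N)%type), k \in ks ->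
       (forall i, i \notin ks -> y i = z i) -> u k y = u k z) ->
  run (map (assign u) ks) x j = if j \in ks then u j x else x j.
Proof.
elim: ks x => //= k ks IHks x /andP[k_ks uniq_ks] u_ext.
rewrite /run /= -/(run _ _) IHks //; last first.
  move=> i y z i_ks yz; apply: u_ext => [|l]; first by rewrite inE i_ks orbT.
  by rewrite inE negb_or => /andP[_ /yz].
rewrite inE; case: ifPn => [j_ks | _].
  rewrite orbT; apply: u_ext => [|i]; first by rewrite inE j_ks orbT.
  by rewrite inE negb_or !ffunE => /andP[/negPf ->].
by rewrite !ffunE orbF; case: eqP => // ->.
Qed.

Lemma procedural_complexity_le (p : seq (transf A N)) (h : transf A N) :
  all (@is_instruction A N) p -> run p =1 h -> procedural_complexity h <= size p.
Proof.
move=> p_i pE; rewrite /procedural_complexity; case: ex_minnP => L _; apply.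
apply/existsP; exists (in_tuple p); rewrite /program_computes p_i.
by apply/forallP => x; rewrite pE.
Qed.

End Assignments.

Arguments assign {A N}.

(** The final contents of memory are unconstrained, so the map that the program computes is itself a
    member of [mem_extensions]. *)
Lemma procedural_complexity_mem_le (A : finType) (n m : nat) (f : transf A n)
    (p : seq (transf A (n + m))) :
    all (@is_instruction A (n + m)) p ->
    (forall x i, run p x (lshift m i) = f (first_cells x) i) ->
  procedural_complexity_mem f m <= size p.
Proof.
move=> p_i pE; pose h : transf A (n + m) := [ffun x => run p x].
apply: (@leq_trans (procedural_complexity h)).
  rewrite /procedural_complexity_mem; case: ex_minnP => L _; apply.
  apply/existsP; exists h; rewrite eqxx andbT inE.
  by apply/forallP => x; apply/forallP => i; rewrite ffunE pE.
by apply: procedural_complexity_le => // x; rewrite ffunE.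
Qed.

(** Writing [n] as [m.+1] keeps subtraction out of the ordinal types. *)
Lemma procedural_complexity_mem_succ (A : finType) (m : nat)
    (f : transf A m.+1) : procedural_complexity_mem f m <= (m + m).+1.
Proof.
pose N := m.+1 + m.
pose cell (i : 'I_m) : 'I_N := lshift m (widen_ord (leqnSn m) i).
pose mem (i : 'I_m) : 'I_N := rshift m.+1 i.
pose last_cell : 'I_N := lshift m ord_max.
pose value (k : 'I_N) (x : (A ^ N)%type) : A :=
  match split k with
  | inl i => f (first_cells x) i
  | inr j => f (first_cells x) (widen_ord (leqnSn m) j)
  end.
(* The fallback [x k] is a default: [copy] is only assigned on [cells], where [insub] succeeds. *)
pose copy (k : 'I_N) (x : (A ^ N)%type) : A :=
  if split k is inl i then
    if insub (val i) is Some j then x (mem j) else x k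
  else x k.
have splitl (i : 'I_m.+1) : split (lshift m i) = inl i := unsplitK (inl i).
have splitr (j : 'I_m) : split (rshift m.+1 j) = inr j := unsplitK (inr j).
have copyE i x : copy (cell i) x = x (mem i) by rewrite /copy splitl /= valK.
have cell_inj : injective cell by move=> i j /(congr1 val) ij; apply: val_inj.
have memNcell i j : mem i != cell j by rewrite /mem /cell eq_rlshift.
pose mems := map mem (enum 'I_m); pose cells := map cell (enum 'I_m).
pose p := map (assign value) mems ++ assign value last_cell
            :: map (assign copy) cells.
have size_p : size p = (m + m).+1.
  by rewrite size_cat /= !size_map -enumT size_enum_ord addnS.
rewrite -size_p; apply: procedural_complexity_mem_le.
  rewrite all_cat /= assign_instruction !all_map.
  by apply/andP; split; apply/allP => k _; apply: assign_instruction.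
move=> x i; rewrite /run foldl_cat /= -/(run _ x) -/(run _ _).
set y := run _ x.
(* [value] reads only the first [m.+1] cells, which are disjoint from [mems]. *)
have yE k : y k = if k \in mems then value k x else x k.
  apply: run_assign => [|_ v w /mapP[j _ ->] vw].
    by rewrite map_inj_uniq ?enum_uniq //; apply: rshift_inj.
  rewrite /value splitr; congr (f _ _); apply/ffunP => l; rewrite !ffunE.
  by apply: vw; apply/mapP => -[j' _ /eqP]; rewrite eq_lrshift.
have y_first : first_cells y = first_cells x.
  apply/ffunP => l; rewrite !ffunE yE; case: ifP => // /mapP[j _ /eqP].
  by rewrite eq_lrshift.
rewrite run_assign; first last.
- move=> _ v w /mapP[j _ ->] vw; rewrite !copyE; apply: vw.
  by apply/mapP => -[j' _ /eqP]; rewrite (negPf (memNcell j j')).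
- by rewrite map_inj_uniq ?enum_uniq.
(* For [i < m] the result comes from memory, which the write to [last_cell] left alone. Otherwise
   the cell is [last_cell], untouched by the copies and computed from [y], whose first cells still
   hold the input. *)
have [lt_im | le_mi] := ltnP i m.
  have -> : lshift m i = cell (Ordinal lt_im) by apply: val_inj.
  rewrite map_f ?mem_enum // copyE !ffunE.
  rewrite [_ == _]eq_rlshift yE map_f ?mem_enum // /value splitr.
  by congr (f _ _); apply: val_inj.
have -> : i = ord_max by apply/val_inj/anti_leq; rewrite le_mi -ltnS ltn_ord.
rewrite ifN; first by rewrite !ffunE eqxx /value splitl y_first.
by apply/mapP => -[j _ /(congr1 val) /= mj]; have := ltn_ord j; rewrite -mj ltnn.
Qed.

Theorem proposition12 (A : finType) (n : nat) (f : transf A n)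
    (hA : 2 <= #|A|) (hn : 2 <= n) :
  procedural_complexity_mem f (n - 1) <= 2 * n - 1.
Proof.
case: n f hn => // m f _; rewrite mul2n -addnn addSn addnS !subn1 /=.
exact: procedural_complexity_mem_succ.
Qed.
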